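(* Let $d\in\mathbb{N}$, $p\in[1,\infty]$, and for $n\in\mathbb{N}$ let $\vec a_n\in\mathbb{R}^d$, $b_n\in\mathbb{R}$ and $L_n(\vec\theta)=\vec a_n\cdot\vec\theta+b_n$ for $\vec\theta\in\mathbb{R}^d$. Put $R_n=|\vec a_n|_p$ and assume $0<R_1\le R_2\le\cdots$. Suppose there is $N\in\mathbb{N}$ such that $R_{n+N}/R_n\ge 2$ for every $n\in\mathbb{N}$. Let $$\delta=\frac{1}{8N\left(\log_2(Nd)+4\log_2(\log_2(Nd)+36)\right)}.$$ Then the set $\{\vec\theta\in\mathbb{R}^d:\ \inf_{n\in\mathbb{N}}\|L_n(\vec\theta)\|\ge\delta\}$ has the cardinality of the continuum.
   Context: For $x\in\mathbb{R}$, $\|x\|=\min_{k\in\mathbb{Z}}|x-k|$ is the distance to the nearest integer. For $\vec a=(a_1,\dots,a_d)\in\mathbb{R}^d$, $|\vec a|_p=(\sum_{i=1}^d|a_i|^p)^{1/p}$ for $p<\infty$ and $|\vec a|_\infty=\max_i|a_i|$. *)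

(* Defs.v *)
From HB Require Import structures.
From mathcomp Require Import all_boot all_order all_algebra.
From mathcomp Require Import all_classical all_reals all_analysis.

Set Implicit Arguments.
Unset Strict Implicit.
Unset Printing Implicit Defensive.

Import Order.TTheory GRing.Theory Num.Theory.

Local Open Scope classical_set_scope.
Local Open Scope ring_scope.

(* The infimum is a minimum: see [distZ_min]. *)
Definition distZ {R : realType} (x : R) : R :=
  inf [set `|x - k%:~R| | k in [set: int]].

Lemma distZ_min (R : realType) (x : R) :
  (exists k : int, distZ x = `|x - k%:~R|) /\
  (forall k : int, distZ x <= `|x - k%:~R|).
Proof.
have lbE : has_lbound [set `|x - k%:~R| | k in [set: int]].
  by exists 0 => _ [k _ <-]; exact: normr_ge0.
have lb k : distZ x <= `|x - k%:~R| by apply: (ge_inf lbE); exists k.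
split=> //; have [fx xf] := andP (floor_itv x).
set f := Num.floor x in fx xf.
have Ef : `|x - f%:~R| = x - f%:~R by rewrite ger0_norm ?subr_ge0.
have Ef1 : `|x - (f + 1)%:~R| = (f + 1)%:~R - x.
  by rewrite distrC gtr0_norm ?subr_gt0.
have nearest k : Num.min `|x - f%:~R| `|x - (f + 1)%:~R| <= `|x - k%:~R|.
  rewrite Ef Ef1 ge_min; have [kf|fk] := lerP k f.
    by rewrite (le_trans _ (ler_norm _)) // lerB // ler_int.
  rewrite distrC orbC (le_trans _ (ler_norm _)) // lerB // ler_int.
  by rewrite lezD1.
have minE : distZ x = Num.min `|x - f%:~R| `|x - (f + 1)%:~R|.
  apply/eqP; rewrite eq_le le_min !lb /=; apply: lb_le_inf.
    by exists `|x - 0%:~R|; exists 0.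
  by move=> _ [k _ <-].
by rewrite minE minEle; case: ifP => _; [exists f | exists (f + 1)].
Qed.

(* Meant for 1 <= p only; the value at -oo is junk. *)
Definition pnorm {R : realType} {d : nat} (p : \bar R) (a : 'rV[R]_d) : R :=
  match p with
  | r%:E => (\sum_(i < d) `|a 0 i| `^ r) `^ r^-1
  | +oo%E => \big[Num.max/0]_(i < d) `|a 0 i|
  | -oo%E => 0
  end.

Definition affine {R : realType} {d : nat} (a : 'rV[R]_d) (b : R)
    (theta : 'rV[R]_d) : R :=
  \sum_(i < d) a 0 i * theta 0 i + b.

Definition log2 {R : realType} (x : R) : R := ln x / ln 2.

Definition delta (R : realType) (N d : nat) : R :=
  1 / (8 * N%:R * (log2 (N * d)%:R + 4 * log2 (log2 (N * d)%:R + 36))).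

(* Main.v *)
Require Import Defs.
From HB Require Import structures.
From mathcomp Require Import all_boot all_order all_algebra.
From mathcomp Require Import all_classical all_reals all_analysis.
From mathcomp Require Import ring lra zify.

(**
  A one-sided Lovasz local lemma on dyadic cubes, in the manner of Peres and Schlag. Up to the
  factor [d ^ (1 / p)], [R_n] bounds some coordinate of [a_n] from below and their mean absolute
  value from above. Hence on cubes of level [l_n], of side about [delta / (d R_n)], the condition
  [||L_n|| < delta] is decided by the centre, while among the subcubes of a cube of side at least
  [32 / R_n] the bad ones have frequency at most about [9 / 4 * delta]: fix all the coordinates
  but one, and count the points of an arithmetic progression near the integers. Since [R_n] at
  least doubles every [N] steps, all but the last [W = N H] constraints, with [H] about
  [log2 (N d / delta)], are decided at so coarse a scale. With [x = 1 / W], the local lemma needs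
  a bad frequency of at most [x (1 - x) ^ (W - 1)], and [1 / (3 W)] suffices for that.

  The potential of a cube, a linear combination of the frequencies of surviving subcubes at [W]
  consecutive stages, loses on average no more than the factor [1 - x] per stage. As
  [(1 - x) ^ N > 1 / 2] while the side of the cubes at least halves every [N] stages, the
  subcubes of positive potential cannot concentrate in two adjacent slabs. So each cube of positive
  potential contains two disjoint such cubes, and iterating this gives a Cantor set of solutions.
*)

Set Implicit Arguments.
Unset Strict Implicit.
Unset Printing Implicit Defensive.

Import Order.TTheory GRing.Theory Num.Theory.

Local Open Scope classical_set_scope.
Local Open Scope card_scope.
Local Open Scope ring_scope.

(** * Terms of an arithmetic progression near the integers *)

Lemma count_nat_itv (R : realType) (n : nat) (A B : R) : A <= B + 1 ->
  \sum_(k < n) (A < k%:R < B)%R%:R <= B + 1 - A.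
Proof.
move=> AB.
(* The first bound carries the induction: if [n] itself is counted, the earlier terms number at most
   [n - A], and [n < B] then gives the second bound. *)
suff: \sum_(k < n) (A < k%:R < B)%R%:R <= Num.max 0 (n%:R - A) /\
      \sum_(k < n) (A < k%:R < B)%R%:R <= B + 1 - A by case.
elim: n => [|n [IH1 IH2]].
  by rewrite big_ord0; split; [rewrite le_max lexx | lra].
rewrite big_ord_recr /=.
have mx : Num.max 0 (n%:R - A) <= Num.max 0 (n.+1%:R - A).
  by rewrite ge_max !le_max lexx /= -natr1; apply/orP; right; lra.
case: (boolP (A < n%:R < B)) => [/andP[An nB]|_] /=; last first.
  by rewrite addr0; split=> //; exact: le_trans mx.
have -> : Num.max 0 (n.+1%:R - A) = n%:R + 1 - A.
  by rewrite -natr1; apply/max_idPr; lra.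
by move: IH1; rewrite (max_idPr _); [move=> IH1; split; lra | lra].
Qed.

(** As [rho <= 1], only integers from [z0] to less than [z0 + n * h + 3] can be close to a term, and
    an open interval of length [2 * rho] around one of them holds at most [2 * rho / h + 1]
    terms. *)
Lemma count_near_int (R : realType) (n : nat) (c h rho : R) :
  0 < h -> 0 < rho <= 1 ->
  \sum_(k < n) `[< exists z : int, `|c + h * k%:R - z%:~R| < rho >]%:R
    <= (n%:R * h + 4) * (2 * rho / h + 1).
Proof.
move=> h0 /andP[r0 r1].
pose z0 := Num.floor (c - 1).
have [z0l z0u] := andP (floor_itv (c - 1)).
rewrite -/z0 intrD in z0l z0u.
pose Q := (Num.truncn (n%:R * h + 3)).+1.
have nh0 : 0 <= n%:R * h by rewrite mulr_ge0 // ltW.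
have Qi : (Num.truncn (n%:R * h + 3))%:R <= n%:R * h + 3 < Q%:R.
  by rewrite truncn_itv //; lra.
have [Ql Qu] := andP Qi.
have step q : \sum_(k < n) (`|c + h * k%:R - (z0 + q)%:~R| < rho)%R%:R
    <= 2 * rho / h + 1.
  pose w : R := (z0 + q)%:~R.
  have := @count_nat_itv R n ((w - rho - c) / h) ((w + rho - c) / h).
  have -> : (w + rho - c) / h + 1 - (w - rho - c) / h = 2 * rho / h + 1.
    by field; apply: lt0r_neq0.
  have le : (w - rho - c) / h <= (w + rho - c) / h + 1.
    apply: (@le_trans _ _ ((w + rho - c) / h)); last by lra.
    by rewrite ler_pM2r ?invr_gt0 //; lra.
  move=> /(_ le); apply: le_trans; apply: ler_sum => k _.
  rewrite ler_nat ltr_pdivrMr // ltr_pdivlMr // -/w ltr_norml.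
  have -> : ((- rho < c + h * k%:R - w) && (c + h * k%:R - w < rho)) =
            ((w - rho - c < k%:R * h) && (k%:R * h < w + rho - c)) => //.
  by congr (_ && _); apply/idP/idP; lra.
apply: (@le_trans _ _ (\sum_(k < n) \sum_(q < Q)
    (`|c + h * k%:R - (z0 + q%:Z)%:~R| < rho)%R%:R)).
  apply: ler_sum => k _; case: (asboolP _) => [[z zk]|_] /=; last first.
    by apply: sumr_ge0.
  have kn : h * k%:R <= n%:R * h.
    by rewrite mulrC ler_pM2r // ler_nat ltnW.
  have k0 : 0 <= h * k%:R by rewrite mulr_ge0 // ltW.
  have := zk; rewrite ltr_norml => /andP[zk1 zk2].
  have zz0 : z0 <= z by rewrite -(ler_int R); lra.
  have Eq : z = z0 + (`|z - z0|%N : int) by rewrite gez0_abs ?subr_ge0 //; ring.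
  have qQ : (`|z - z0| < Q)%N.
    rewrite -(ltr_nat R) natr_absz ger0_norm ?subr_ge0 // intrD mulrNz.
    by apply: le_lt_trans Qu; lra.
  by rewrite (bigD1 (Ordinal qQ)) //= -Eq zk lerDl sumr_ge0.
rewrite exchange_big /=.
apply: (@le_trans _ _ (\sum_(q < Q) (2 * rho / h + 1))).
  by apply: ler_sum => q _; exact: step.
rewrite sumr_const card_ord -[_ *+ Q]mulr_natl ler_pM2r.
  by rewrite /Q -natr1; lra.
by apply: addr_gt0 => //; rewrite divr_gt0 // mulr_gt0.
Qed.

(* The factor [9/8] is [1 + 4/32]: the [4] comes from the two ends of the progression. *)
Lemma freq_near_int (R : realType) (n : nat) (c h rho : R) :
  h != 0 -> 0 < rho <= 1 -> 32 <= n%:R * `|h| ->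
  \sum_(k < n) `[< exists z : int, `|c + h * k%:R - z%:~R| < rho >]%:R
    <= 9 / 8 * (2 * rho + `|h|) * n%:R.
Proof.
wlog h0 : c h / 0 < h.
  move=> wl hN0; have [h0|h0] := ltP 0 h; first exact: wl.
  have h1 : 0 < - h by rewrite oppr_gt0 lt_neqAle hN0.
  move=> rho01 nh; have := wl (- c) (- h) h1 (lt0r_neq0 h1) rho01.
  rewrite normrN => /(_ nh); apply: le_trans; apply: ler_sum => k _.
  rewrite ler_nat; case: asboolP => // -[z zP].
  case: asboolP => // -[]; exists (- z).
  by rewrite mulrNz -normrN; congr (`|_| < rho): zP; ring.
move=> _ rho01; rewrite gtr0_norm // => nh.
apply: (le_trans (count_near_int n c h0 rho01)).
have -> : 9 / 8 * (2 * rho + h) * n%:R =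
          (9 / 8 * (n%:R * h)) * (2 * rho / h + 1).
  by field; apply: lt0r_neq0.
rewrite ler_pM2r; first by lra.
by case/andP: rho01 => r0 _; apply: addr_gt0 => //; rewrite divr_gt0 // mulr_gt0.
Qed.

(** * Dyadic cubes and averages over subcubes *)

(* [v : 'I_d -> nat] stands for the cube of side [h] with corner [h * v]; it splits into
   [n ^ d] cubes of side [h / n], namely the [subcube n v u]. *)
Definition subcube d n (v : 'I_d -> nat) (u : {ffun 'I_d -> 'I_n}) : 'I_d -> nat :=
  fun i => (n * v i + u i)%N.

Definition supercube d n (v : 'I_d -> nat) : 'I_d -> nat := fun i => (v i %/ n)%N.

Definition avg (R : realType) d n (phi : ('I_d -> nat) -> R) (v : 'I_d -> nat) : R :=
  (n ^ d)%:R^-1 * \sum_(u : {ffun 'I_d -> 'I_n}) phi (subcube v u).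

Lemma supercubeK d n (v : 'I_d -> nat) (u : {ffun 'I_d -> 'I_n}) :
  supercube n (subcube v u) = v.
Proof.
apply/funext => i; rewrite /supercube /subcube.
have n0 : (0 < n)%N by case: (u i) => [m /=]; case: n {u}.
by rewrite mulnC divnMDl // divn_small // addn0.
Qed.

Lemma supercubeM d m n (v : 'I_d -> nat) :
  supercube m (supercube n v) = supercube (n * m) v.
Proof. by apply/funext => i; rewrite /supercube divnMA. Qed.

Lemma supercube1 d (v : 'I_d -> nat) : supercube 1 v = v.
Proof. by apply/funext => i; rewrite /supercube divn1. Qed.

Section avg_theory.
Context {R : realType} {d : nat}.
Implicit Types (phi psi : ('I_d -> nat) -> R) (v : 'I_d -> nat).

Lemma avg1 phi v : avg 1 phi v = phi v.
Proof.
rewrite /avg exp1n invr1 mul1r (bigD1 [ffun=> ord0]) //= big1 ?addr0.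
  by congr phi; apply/funext => i; rewrite /subcube ffunE mul1n addn0.
by move=> u /eqP[]; apply/ffunP => i; rewrite ffunE; apply: ord1.
Qed.

Lemma avgM m n phi v : avg (m * n) phi v = avg m (avg n phi) v.
Proof.
rewrite /avg -mulr_sumr mulrA expnMn natrM invfM; congr (_ * _).
have mn_gt0 (w : 'I_(m * n)) : (0 < n)%N.
  by case: n w => [|//]; rewrite muln0 => -[].
have lt1 (w : 'I_(m * n)) : (w %/ n < m)%N by rewrite ltn_divLR // mn_gt0.
have lt2 (w : 'I_(m * n)) : (w %% n < n)%N by rewrite ltn_mod mn_gt0.
have lt3 (u : 'I_m) (w : 'I_n) : (u * n + w < m * n)%N.
  by case: u w => [u um] [w wn] /=; nia.
(* An offset below [m * n] is a pair of digits, quotient and remainder by [n]; [h] and [g] are the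
   two directions of this bijection. *)
pose h (p : {ffun 'I_d -> 'I_m} * {ffun 'I_d -> 'I_n}) :=
  [ffun i => Ordinal (lt3 (p.1 i) (p.2 i))].
pose g (w : {ffun 'I_d -> 'I_(m * n)}) :=
  ([ffun i => Ordinal (lt1 (w i))], [ffun i => Ordinal (lt2 (w i))]).
rewrite pair_bigA /= (reindex h) /=.
  apply: eq_bigr => -[u w] _ /=; congr phi; apply/funext => i.
  by rewrite /subcube ffunE /=; nia.
exists g => [[u w] _|w _].
  congr pair; apply/ffunP => i; apply/val_inj; rewrite !ffunE /=.
    by rewrite divnMDl ?divn_small ?addn0 // (leq_ltn_trans _ (ltn_ord (w i))).
  by rewrite modnMDl modn_small.
apply/ffunP => i; apply/val_inj; rewrite !ffunE /=.
by rewrite -divn_eq.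
Qed.

Lemma avgB n phi psi v : avg n (fun w => phi w - psi w) v = avg n phi v - avg n psi v.
Proof. by rewrite /avg -mulrBr -sumrB. Qed.

Lemma avgZ n c phi v : avg n (fun w => c * phi w) v = c * avg n phi v.
Proof. by rewrite /avg -mulr_sumr mulrCA. Qed.

Lemma avg_sum n I (r : seq I) (F : I -> ('I_d -> nat) -> R) v :
  avg n (fun w => \sum_(i <- r) F i w) v = \sum_(i <- r) avg n (F i) v.
Proof. by rewrite /avg exchange_big mulr_sumr. Qed.

Lemma le_avg n phi psi v :
  (forall w, supercube n w = v -> phi w <= psi w) -> avg n phi v <= avg n psi v.
Proof.
move=> le; rewrite ler_wpM2l ?invr_ge0 ?ler0n //; apply: ler_sum => u _.
by apply: le; rewrite supercubeK.
Qed.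

Lemma eq_avg n phi psi v :
  (forall w, supercube n w = v -> phi w = psi w) -> avg n phi v = avg n psi v.
Proof. by move=> e; apply/eqP; rewrite eq_le !le_avg // => w /e ->. Qed.

Lemma avg_cst n (c : R) v : (0 < n)%N -> avg n (fun=> c) v = c.
Proof.
move=> n0; rewrite /avg sumr_const card_ffun !card_ord -[c *+ _]mulr_natl mulKf //.
by rewrite pnatr_eq0 -lt0n expn_gt0 n0.
Qed.

Lemma avg_super n phi v : (0 < n)%N -> avg n (fun w => phi (supercube n w)) v = phi v.
Proof. by move=> n0; rewrite -[RHS](@avg_cst n _ v n0); apply: eq_avg => w ->. Qed.

Lemma avg_gt0_ex n phi v : 0 < avg n phi v ->
  exists2 w, supercube n w = v & 0 < phi w.
Proof.
move=> gt0; apply: contrapT => no; move: gt0; apply/negP; rewrite -leNgt.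
rewrite /avg mulr_ge0_le0 ?invr_ge0 ?ler0n //; apply: sumr_le0 => u _.
rewrite leNgt; apply/negP => gt0; apply: no.
by exists (subcube v u) => //; rewrite supercubeK.
Qed.

Definition with_coord v (i : 'I_d) (c : nat) : 'I_d -> nat :=
  fun k => if k == i then c else v k.

(** Fubini: the average over a cube is an average of averages along lines in direction [i], so a
    bound uniform over these lines suffices. *)
Lemma avg_le_slice n phi v (i : 'I_d) (q : R) : (0 < n)%N ->
  (forall w, \sum_(c < n) phi (with_coord w i (n * v i + c)%N) <= q * n%:R) ->
  avg n phi v <= q.
Proof.
move=> n0 sl; have nd : 0 < (n ^ d)%:R :> R by rewrite ltr0n expn_gt0 n0.
have n0' : 0 < n%:R :> R by rewrite ltr0n.
rewrite /avg mulrC ler_pdivrMr // -(ler_pM2r n0').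
pose upd (u : {ffun 'I_d -> 'I_n}) c := [ffun k => if k == i then c else u k].
have -> : (\sum_(u : {ffun 'I_d -> 'I_n}) phi (subcube v u)) * n%:R =
    \sum_(u : {ffun 'I_d -> 'I_n}) \sum_(c < n) phi (subcube v (upd u c)).
  transitivity (\sum_(u : {ffun 'I_d -> 'I_n}) \sum_(c < n) phi (subcube v u)).
    by rewrite mulr_suml; apply: eq_bigr => u _; rewrite sumr_const card_ord mulr_natr.
  (* swapping [u i] with [c] is an involution of the pairs [(u, c)] *)
  rewrite !pair_bigA /=.
  pose sw (p : {ffun 'I_d -> 'I_n} * 'I_n) := (upd p.1 p.2, p.1 i).
  have swK : involutive sw.
    case=> u c; rewrite /sw /=; congr pair; last by rewrite ffunE eqxx.
    by apply/ffunP => k; rewrite !ffunE; case: eqP => [->|].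
  by rewrite (reindex sw) //; exists sw => p _; rewrite swK.
apply: (@le_trans _ _ (\sum_(u : {ffun 'I_d -> 'I_n}) q * n%:R)).
  apply: ler_sum => u _; apply: le_trans (sl (subcube v u)).
  rewrite le_eqVlt; apply/orP; left; apply/eqP.
  apply: eq_bigr => c _; congr phi; apply/funext => k.
  by rewrite /with_coord /subcube ffunE; case: eqP => [->|].
rewrite sumr_const card_ffun !card_ord -[(q * n%:R) *+ _]mulr_natr.
by rewrite mulrAC.
Qed.

End avg_theory.

(** * The Bernoulli inequality and the one-sided local lemma *)

Lemma bernoulli_ineq (R : realFieldType) (x : R) n : -1 <= x -> 1 + n%:R * x <= (1 + x) ^+ n.
Proof.
move=> x1; elim: n => [|n IH]; first by rewrite mul0r addr0 expr0.
rewrite exprS -natr1; apply: (@le_trans _ _ ((1 + x) * (1 + n%:R * x))).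
  have : 0 <= n%:R * (x * x) by rewrite mulr_ge0 // -expr2 sqr_ge0.
  lra.
by rewrite ler_wpM2l //; lra.
Qed.

Lemma expr_unbounded (R : realType) (y C : R) : 1 < y -> exists k, C < y ^+ k.
Proof.
move=> y1; have y10 : 0 < y - 1 by lra.
have c0 : 0 <= `|C / (y - 1)| by [].
exists (Num.truncn `|C / (y - 1)|).+1.
have /andP[_ h] := truncn_itv c0; set k := _.+1 in h *.
have -> : y = 1 + (y - 1) by ring.
apply: lt_le_trans (@bernoulli_ineq _ (y - 1) k _); last by lra.
have : C < k%:R * (y - 1).
  by rewrite -ltr_pdivrMr //; apply: le_lt_trans h; exact: ler_norm.
lra.
Qed.

Section local_lemma.
Context {R : realType} {d : nat} (w : nat) (lev : nat -> nat)
  (F : nat -> ('I_d -> nat) -> R) (x : R).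
Hypothesis x01 : 0 < x < 1.
Hypothesis lev_mono : {homo lev : i j / (i <= j)%N}.

Local Notation lam := (1 - x).

Lemma lam_gt0 : 0 < lam. Proof. by case/andP: x01 => _; rewrite subr_gt0. Qed.

(** For [F] the indicator of the surviving cubes, the proportion of survivors among the descendants
    of a cube [i] stages later. *)
Definition survival j i : ('I_d -> nat) -> R :=
  avg (2 ^ (lev (j + i) - lev j)) (F (j + i)).

(** The condition of the local lemma: passing from stage [j + w] to the next one costs a cube of
    stage [j] at most [x * lam ^+ w] in frequency, and nothing if [F j v = 0]. *)
Hypothesis survival_step : forall j v,
  survival j w v - x * lam ^+ w * F j v <= survival j w.+1 v.

(* The weights make [lam] times the potential of stage [j] at most the average potential of
   stage [j + 1]; this takes the place of the conditional probabilities of the usual local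
   lemma, for which divisions by possibly null densities would be needed. *)
Definition potential j v : R :=
  survival j w v - x * \sum_(i < w) lam ^+ (w.-1 - i) * survival j i v.

Lemma survivalS j i v :
  avg (2 ^ (lev j.+1 - lev j)) (survival j.+1 i) v = survival j i.+1 v.
Proof.
rewrite /survival -avgM -expnD addSnnS; congr (avg (2 ^ _) _ _).
by rewrite addnC addnBA ?lev_mono // subnK // lev_mono //; lia.
Qed.

Lemma survival0 j v : survival j 0 v = F j v.
Proof. by rewrite /survival addn0 subnn expn0 avg1. Qed.

(** Averaging raises the second index of every [survival] by one. Because the weights are geometric,
    all terms cancel but the extreme ones, and these form exactly [survival_step]. *)
Lemma potential_step j v :
  lam * potential j v <= avg (2 ^ (lev j.+1 - lev j)) (potential j.+1) v.
Proof.
rewrite /potential avgB survivalS avgZ avg_sum.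
under [in leRHS]eq_bigr do rewrite avgZ survivalS.
have := survival_step j v; rewrite -survival0.
case: w => [|u]; first by rewrite !big_ord0; lra.
rewrite big_ord_recl big_ord_recr /= !subn0 subnn expr0.
set S := \sum_(i < u) _; set S' := \sum_(i < u) _.
have -> : S' = lam * S.
  rewrite /S /S' mulr_sumr; apply: eq_bigr => i _.
  rewrite /bump /= add1n mulrA -exprS; congr (_ ^+ _ * _).
  by have := ltn_ord i; lia.
rewrite exprS; lra.
Qed.

Lemma potential_iter j n v :
  lam ^+ n * potential j v <= avg (2 ^ (lev (j + n) - lev j)) (potential (j + n)) v.
Proof.
have l0 := ltW lam_gt0.
elim: n => [|n IH] in j v *.
  by rewrite addn0 subnn expn0 avg1 expr0 mul1r.
rewrite exprSr -mulrA; apply: (le_trans (ler_wpM2l _ (potential_step j v))).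
  exact: exprn_ge0.
rewrite -avgZ; apply: (le_trans (le_avg (fun u _ => IH j.+1 u))).
rewrite -avgM -expnD addSnnS [(_ - _ + _)%N]addnC addnBA ?lev_mono //.
by rewrite subnK // lev_mono //; lia.
Qed.

Hypothesis F01 : forall j v, 0 <= F j v <= 1.
Hypothesis F_super : forall j j' v, (j <= j')%N ->
  0 < F j' v -> 0 < F j (supercube (2 ^ (lev j' - lev j)) v).

Lemma expn2_gt0 k : (0 < 2 ^ k)%N. Proof. by rewrite expn_gt0. Qed.

Lemma potential_le_survival j v : potential j v <= survival j w v.
Proof.
have l0 := ltW lam_gt0.
rewrite lerBlDr lerDl mulr_ge0 //; first by case/andP: x01 => /ltW.
apply: sumr_ge0 => i _; rewrite mulr_ge0 ?exprn_ge0 //.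
rewrite /survival -[0](@avg_cst _ _ (2 ^ (lev (j + i) - lev j)) 0 v) ?expn2_gt0 //.
by apply: le_avg => u _; case/andP: (F01 (j + i) u).
Qed.

Lemma potential_le1 j v : potential j v <= 1.
Proof.
apply: (le_trans (potential_le_survival j v)).
rewrite /survival -[leRHS](@avg_cst _ _ (2 ^ (lev (j + w) - lev j)) 1 v) ?expn2_gt0 //.
by apply: le_avg => u _; case/andP: (F01 (j + w) u).
Qed.

(** A positive potential forces a survivor [w] stages later, and survival passes up to the enclosing
    cube. *)
Lemma potential_gt0 j v : 0 < potential j v -> 0 < F j v.
Proof.
move=> /lt_le_trans/(_ (potential_le_survival j v))/avg_gt0_ex[u <- Fu].
by apply: F_super Fu; rewrite leq_addr.
Qed.

(** All the frequencies involved are 1, and the geometric sum leaves [1 - (1 - lam ^+ w)]. *)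
Lemma potential_start v : (forall j u, (j <= w)%N -> F j u = 1) ->
  potential 0 v = lam ^+ w.
Proof.
move=> F1.
have S1 i : (i <= w)%N -> survival 0 i v = 1.
  move=> iw; rewrite -[RHS](@avg_cst _ _ (2 ^ (lev (0 + i) - lev 0)) 1 v) ?expn2_gt0 //.
  by apply: eq_avg => u _; rewrite F1.
rewrite /potential S1 //.
under eq_bigr do rewrite S1 ?mulr1 1?ltnW //.
rewrite (reindex_inj rev_ord_inj) /=.
under eq_bigr => i _.
  have -> : (w.-1 - (w - i.+1) = i)%N by have := ltn_ord i; lia.
  over.
have := subrX1 lam w; have -> : lam - 1 = - x by ring.
set S := \sum_(i < w) _ => E.
suff -> : x * S = 1 - lam ^+ w by ring.
by rewrite -[1 - _]opprB E; ring.
Qed.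

Lemma avg_coord_le n i c (v : 'I_d -> nat) : (0 < n)%N ->
  avg n (fun u => (u i == c)%:R : R) v <= n%:R^-1.
Proof.
move=> n0; apply: (avg_le_slice (i := i)) => // u.
rewrite mulVf ?pnatr_eq0 -?lt0n //.
under eq_bigr do rewrite /with_coord eqxx.
have [cn|cn] := boolP [exists k : 'I_n, (n * v i + k == c)%N].
  have [k /eqP kc] := existsP cn.
  rewrite (bigD1 k) //= kc eqxx big1 ?addr0 // => k' k'k.
  rewrite -kc eqn_add2l; apply/eqP; rewrite pnatr_eq0 eqb0.
  by apply: contraNN k'k => /eqP ?; apply/eqP/val_inj.
rewrite big1 // => k _; apply/eqP; rewrite pnatr_eq0 eqb0.
by apply: contraNN cn => e; apply/existsP; exists k.
Qed.

Variable N : nat.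
Hypothesis N_gt0 : (0 < N)%N.
Hypothesis lev_grow : forall j k, (lev j + k <= lev (j + w + N * k))%N.
Hypothesis lamN : 1 < 2 * lam ^+ N.

(* The gap of 2 makes the two closed cubes disjoint. If there were no such pair then all the
   descendants of positive potential of stage [j'] would lie in two adjacent slabs, of total
   frequency [2 ^ (1 - lev j' + lev j)], and potentials decay more slowly than that. *)
Lemma potential_split (i0 : 'I_d) j v : 0 < potential j v ->
  exists j', (j < j')%N /\ exists u1 u2,
    [/\ supercube (2 ^ (lev j' - lev j)) u1 = v /\ 0 < potential j' u1,
        supercube (2 ^ (lev j' - lev j)) u2 = v /\ 0 < potential j' u2
      & ((u1 i0).+2 <= u2 i0)%N].
Proof.
move=> P0; have l0 := lam_gt0.
have lw0 : 0 < lam ^+ w * potential j v by rewrite mulr_gt0 ?exprn_gt0.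
(* [k] is so large that the guaranteed average [lam ^+ (w + N * k.+1) * potential j v] exceeds
   [2 / 2 ^+ k.+1], the most that two slabs can carry. *)
have [k hk] := @expr_unbounded R _ (2 / (lam ^+ w * potential j v)) lamN.
have {}hk : 2 / (lam ^+ w * potential j v) < (2 * lam ^+ N) ^+ k.+1.
  by apply: lt_le_trans hk _; rewrite exprSr ler_peMr // ltW // ?exprn_gt0 // (lt_trans ltr01).
pose j' := (j + (w + N * k.+1))%N.
exists j'; split; first by rewrite /j'; lia.
apply: contrapT => no.
pose n := (2 ^ (lev j' - lev j))%N.
pose good u := supercube n u = v /\ 0 < potential j' u.
have gap u1 u2 : good u1 -> good u2 -> (u2 i0 <= (u1 i0).+1)%N.
  move=> g1 g2; rewrite leqNgt; apply/negP => h; apply: no.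
  by exists u1, u2.
have iter := @potential_iter j (w + N * k.+1) v; rewrite -/j' -/n in iter.
have gt0 : 0 < avg n (potential j') v.
  by apply: lt_le_trans iter; rewrite mulr_gt0 ?exprn_gt0.
have exc : exists c, `[< exists2 u, good u & u i0 = c >].
  have [u uv Pu] := avg_gt0_ex gt0; exists (u i0); apply/asboolP; exists u => //.
(* With [c] the least [i0]-th coordinate of a good descendant, [gap] leaves only the values [c] and
   [c.+1]. *)
have [c /asboolP[u0 g0 u0c] cmin] := ex_minnP exc.
have n0 : (0 < n)%N by exact: expn2_gt0.
have le2 : avg n (potential j') v <= 2 / n%:R.
  apply: (@le_trans _ _ (avg n (fun u => (u i0 == c)%:R : R) v -
      avg n (fun u => -1 * (u i0 == c.+1)%:R : R) v)); last first.
    have h1 := avg_coord_le i0 c v n0; have h2 := avg_coord_le i0 c.+1 v n0.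
    rewrite avgZ; lra.
  rewrite -avgB; apply: le_avg => u uv.
  have [Pu|Pu] := ltP 0 (potential j' u); last first.
    by apply: (le_trans Pu); rewrite mulN1r opprK addr_ge0.
  have gu : good u by [].
  have uc : (u i0 <= c.+1)%N by rewrite -u0c; apply: gap.
  have cu : (c <= u i0)%N by apply: cmin; apply/asboolP; exists u.
  apply: (le_trans (potential_le1 _ _)); rewrite mulN1r opprK.
  have : (u i0 == c) || (u i0 == c.+1) by lia.
  by case/orP => /eqP ->; rewrite eqxx ?lerDl ?lerDr.
have nk : (2 ^ k.+1 <= n)%N.
  by rewrite leq_exp2l // leq_subRL ?lev_mono /j' ?addnA ?lev_grow //; lia.
have : lam ^+ (w + N * k.+1) * potential j v <= 2 / 2 ^+ k.+1.
  apply: (le_trans iter); apply: (le_trans le2).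
  rewrite ler_pM2l // -natrX lef_pV2 ?posrE ?ltr0n ?expn2_gt0 //.
  by rewrite ler_nat.
apply/negP; rewrite -ltNge ltr_pdivrMr ?exprn_gt0 //.
move: hk; rewrite ltr_pdivrMr // exprMn exprD exprM.
by congr (_ < _); ring.
Qed.

End local_lemma.

(** * From splitting cubes to a Cantor set of points *)

Section cantor_scheme.
Context {R : realType} {d : nat} (s : R) (lev : nat -> nat)
  (good : nat -> ('I_d -> nat) -> Prop) (i0 : 'I_d).
Hypothesis s0 : 0 < s.

Definition in_cube t (v : 'I_d -> nat) (theta : 'rV[R]_d) :=
  forall i, (v i)%:R * s / 2 ^+ t <= theta 0 i <= (v i).+1%:R * s / 2 ^+ t.

Lemma supercube_itv t t' (v : 'I_d -> nat) i : (t <= t')%N ->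
  let v0 := supercube (2 ^ (t' - t)) v in
  (v0 i)%:R * s / 2 ^+ t <= (v i)%:R * s / 2 ^+ t' /\
  (v i).+1%:R * s / 2 ^+ t' <= (v0 i).+1%:R * s / 2 ^+ t.
Proof.
move=> tt' v0; rewrite /v0 /supercube -[in 2 ^+ t'](subnK tt').
set n := (t' - t)%N; pose e := s / 2 ^+ t.
have n0 : (0 < 2 ^ n)%N by rewrite expn_gt0.
have n0' : 0 < (2 ^ n)%:R :> R by rewrite ltr0n.
have e0 : 0 < e by rewrite divr_gt0 ?exprn_gt0.
have E (c : R) : c * s / 2 ^+ (n + t) = c / (2 ^ n)%:R * e.
  by rewrite /e exprD natrX; field; rewrite !expf_neq0 ?pnatr_eq0.
have E0 (c : R) : c * s / 2 ^+ t = c * e by rewrite mulrA.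
rewrite !E !E0 !ler_pM2r // ler_pdivlMr // ler_pdivrMr // -!natrM !ler_nat.
split; first exact: leq_divM.
by rewrite -ltn_divLR.
Qed.

Hypothesis lev_mono : {homo lev : i j / (i <= j)%N}.
Hypothesis split : forall j v, good j v ->
  exists j', (j < j')%N /\ exists u1 u2,
    [/\ supercube (2 ^ (lev j' - lev j)) u1 = v /\ good j' u1,
        supercube (2 ^ (lev j' - lev j)) u2 = v /\ good j' u2
      & ((u1 i0).+2 <= u2 i0)%N].

Let node := {q : nat * ('I_d -> nat) | good q.1 q.2}.
Let stage (q : node) := (sval q).1.
Let cell (q : node) := (sval q).2.
Let below (q q' : node) := (stage q < stage q')%N /\
  supercube (2 ^ (lev (stage q') - lev (stage q))) (cell q') = cell q.

Let lo (q : node) i : R := (cell q i)%:R * s / 2 ^+ lev (stage q).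
Let hi (q : node) i : R := (cell q i).+1%:R * s / 2 ^+ lev (stage q).

(** A binary sequence selects a branch of nested closed cubes and so a point. Two sequences part at
    their first difference, into cubes whose projections to the axis [i0] are disjoint. *)
Lemma cantor_scheme v : good 0 v ->
  exists g : (nat -> bool) -> 'rV[R]_d,
    injective (fun b => g b 0 i0) /\
    forall b J, exists j u, [/\ (J <= j)%N, good j u & in_cube (lev j) u (g b)].
Proof.
move=> good_v.
have [f fP] : {f : node -> node * node & forall q,
    [/\ below q (f q).1, below q (f q).2 & hi (f q).1 i0 < lo (f q).2 i0]}.
  apply: (@choice _ _ (fun q (c : node * node) =>
    [/\ below q c.1, below q c.2 & hi c.1 i0 < lo c.2 i0])).
  case=> [[j u] /= gu]; have [j' [jj' [u1 [u2 [[e1 g1] [e2 g2] h]]]]] := split gu.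
  exists (exist _ (j', u1) g1, exist _ (j', u2) g2); split=> //.
  rewrite /lo /hi /= ltr_pM2r ?invr_gt0 ?exprn_gt0 // ltr_pM2r //.
  by rewrite ltr_nat.
pose fix path (b : nat -> bool) n : node :=
  if n is n'.+1 then (if b n' then (f (path b n')).2 else (f (path b n')).1)
  else exist _ (0%N, v) good_v.
have below_path b n : below (path b n) (path b n.+1).
  by have [h1 h2 _] := fP (path b n) => /=; case: (b n).
have stageP b n : (n <= stage (path b n))%N.
  elim: n => // n IH; apply: leq_ltn_trans IH _.
  by have [] := below_path b n.
have nest b n i : lo (path b n) i <= lo (path b n.+1) i /\
                  hi (path b n.+1) i <= hi (path b n) i.
  have [lt e] := below_path b n; rewrite /lo /hi -e.
  by apply: supercube_itv; apply/lev_mono/ltnW.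
have lo_hi q i : lo q i <= hi q i.
  by rewrite ler_pM2r ?invr_gt0 ?exprn_gt0 // ler_pM2r // ler_nat.
have lo_mono b i : {homo (fun n => lo (path b n) i) : m n / (m <= n)%N >-> m <= n}.
  by apply: homo_leq => // [y x z|n]; [exact: le_trans | case: (nest b n i)].
have hi_mono b i : {homo (fun n => hi (path b n) i) : m n / (m <= n)%N >-> n <= m}.
  apply: (@homo_leq _ _ (fun x y => y <= x)) => // [y x z h1 h2|n].
    exact: le_trans h2 h1.
  by case: (nest b n i).
have lohi b i m n : lo (path b m) i <= hi (path b n) i.
  apply: (le_trans (lo_mono b i m (maxn m n) (leq_maxl _ _))).
  apply: (le_trans (lo_hi _ _)); exact: hi_mono (leq_maxr _ _).
(* The supremum of the lower corners lies in all cubes of the branch, whether or not they shrink to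
   a point. *)
pose g b : 'rV[R]_d := \row_i sup (range (fun n => lo (path b n) i)).
have gP b n i : lo (path b n) i <= g b 0 i <= hi (path b n) i.
  rewrite mxE; apply/andP; split.
    apply: ub_le_sup; last by exists n.
    by exists (hi (path b 0%N) i) => _ [m _ <-].
  apply: ge_sup; first by exists (lo (path b 0%N) i); exists 0%N.
  by move=> _ [m _ <-].
exists g; split=> [b b' gbb'|b J]; last first.
  exists (stage (path b J)), (cell (path b J)); split=> //; last exact: gP.
  exact: (svalP (path b J)).
apply: contrapT => bb'.
have exn : exists n, b n != b' n.
  apply: contrapT => no; apply: bb'; apply/funext => n; apply/eqP.
  by apply: contraPT no => h no; apply: no; exists n.
have [n bn nmin] := ex_minnP exn.
have pe m : (m <= n)%N -> path b m = path b' m.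
  elim: m => //= m IH mn; rewrite -IH ?(ltnW mn) //.
  by have [->//|/nmin] := eqVneq (b m) (b' m); rewrite leqNgt mn.
have [_ _ gap] := fP (path b n).
have := gP b n.+1 i0; have := gP b' n.+1 i0; rewrite /= -pe // gbb'.
move: bn; case: (b n) (b' n) => [] [] // _ /andP[h1 h2] /andP[h3 h4].
  by have := lt_le_trans gap h3; rewrite ltNge h2.
by have := lt_le_trans gap h1; rewrite ltNge h4.
Qed.

End cantor_scheme.

(** * Numerical and Lipschitz estimates *)

(** From [exp (-1/6) >= 5/6] follows [e <= (6/5)^6 = 2.98...]. *)
Lemma expR1_lt3 (R : realType) : expR 1 < 3 :> R.
Proof.
have h : expR (6^-1) <= 6 / 5 :> R.
  have := @expR_ge1Dx R (- 6^-1); rewrite expRN => h.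
  by rewrite -[leLHS]invrK invf_ple ?posrE ?invr_gt0 ?expR_gt0 //; lra.
have -> : 1 = 6^-1 * 6%:R :> R by rewrite mulVf.
rewrite expRM_natr; apply: (@le_lt_trans _ _ ((6 / 5) ^+ 6)); last by lra.
by rewrite lerXn2r // nnegrE ?expR_ge0 //; lra.
Qed.

(** For [w > 0] the power is the inverse of [(1 + 1/w)^w], which is at most [e < 3]. *)
Lemma exprn_1BV_ge (R : realType) w : (3 : R)^-1 <= (1 - w.+1%:R^-1) ^+ w.
Proof.
case: w => [|w]; first by rewrite expr0; lra.
have w0 : 0 < w.+1%:R :> R by rewrite ltr0n.
have w1 : 0 < w.+2%:R :> R by rewrite ltr0n.
have -> : 1 - w.+2%:R^-1 = (1 + w.+1%:R^-1)^-1 :> R.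
  rewrite -natr1; move: w0; set y : R := w.+1%:R => y0.
  by field; apply/andP; split; apply: lt0r_neq0; lra.
rewrite exprVn lef_pV2 ?posrE ?exprn_gt0 ?addr_gt0 ?invr_gt0 //.
apply/ltW/(le_lt_trans _ (expR1_lt3 R)).
rewrite -[in leRHS](mulVf (lt0r_neq0 w0)) expRM_natr.
by rewrite lerXn2r ?nnegrE ?expR_ge0 ?addr_ge0 ?invr_ge0 ?expR_ge1Dx ?ltW.
Qed.

Lemma distZ_le (R : realType) (x : R) (k : int) : distZ x <= `|x - k%:~R|.
Proof. by case: (distZ_min x) => _; apply. Qed.

Lemma distZ_lipschitz (R : realType) (x y : R) : distZ x <= distZ y + `|x - y|.
Proof.
have [[k ->] _] := distZ_min y; apply: (le_trans (distZ_le x k)).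
have -> : x - k%:~R = (y - k%:~R) + (x - y) by ring.
exact: ler_normD.
Qed.

Lemma affine_dist_le (R : realType) d (a : 'rV[R]_d) b (x y : 'rV[R]_d) e :
  (forall i, `|x 0 i - y 0 i| <= e) ->
  `|affine a b x - affine a b y| <= (\sum_i `|a 0 i|) * e.
Proof.
move=> xy; rewrite /affine opprD addrACA subrr addr0 -sumrB mulr_suml.
apply: (le_trans (ler_norm_sum _ _ _)); apply: ler_sum => i _.
by rewrite -mulrBr normrM ler_wpM2l.
Qed.

Lemma supercubeB d t t' t'' (v : 'I_d -> nat) : (t <= t' <= t'')%N ->
  supercube (2 ^ (t' - t)) (supercube (2 ^ (t'' - t')) v) = supercube (2 ^ (t'' - t)) v.
Proof.
move=> /andP[tt' tt'']; rewrite supercubeM -expnD; congr (supercube (2 ^ _) _); lia.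
Qed.

(** * Lacunary affine forms: bad cubes and their frequency *)

Section lacunary.
Context {R : realType} {d : nat} (a : nat -> 'rV[R]_d) (b : nat -> R)
  (r : nat -> R) (N H : nat) (delta : R) (i0 : 'I_d).
Hypothesis N0 : (0 < N)%N.
Hypothesis H3 : (2 < H)%N.
Hypothesis delta0 : 0 < delta.
(** [HE] lets [N * H] steps of growth turn a cube on which one form is almost constant into one long
    for a later form. [delta_le] says that [81 / 32 * delta], the bad frequency, is at most
    [1 / (3 * N * H)]. *)
Hypothesis HE : 512 * d%:R / delta <= 2 ^+ H.
Hypothesis delta_le : 243 / 32 * delta * (N * H)%:R <= 1.
Hypothesis r0 : 0 < r 0%N.
Hypothesis r_mono : {homo r : m n / (m <= n)%N >-> m <= n}.
Hypothesis r_lac : forall n, 2 * r n <= r (n + N)%N.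
Hypothesis sum_le : forall n, \sum_i `|a n 0 i| <= d%:R * r n.
Hypothesis coord_ge : forall n, exists i, r n <= `|a n 0 i|.

(** The choice [x = 1 / (w + 1)] maximises [x * (1 - x) ^+ w]; the side [s] makes the initial cube
    just long enough for the form of index 0. *)
Let w := (N * H).-1.
Let x : R := (N * H)%:R^-1.
Let s : R := 32 / r 0%N.

Let NH3 : (3 <= N * H)%N. Proof. by nia. Qed.
Let wE : w.+1 = (N * H)%N. Proof. by rewrite prednK //; lia. Qed.

Let r_gt0 n : 0 < r n. Proof. exact: lt_le_trans r0 (r_mono _). Qed.
Let s0 : 0 < s. Proof. by rewrite divr_gt0. Qed.
Let d1 : 1 <= d%:R :> R.
Proof. by rewrite ler1n; case: i0 => k; case: d. Qed.
Let d0 : 0 < d%:R :> R. Proof. exact: lt_le_trans d1. Qed.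

Let delta_lt : delta < 1 / 16.
Proof.
have h3 : 3 <= (N * H)%:R :> R by rewrite ler_nat.
have := ler_wpM2l (ltW delta0) h3; move: delta_le.
by move: (N * H)%:R => q; lra.
Qed.

Let drs n : 32 <= d%:R * r n * s.
Proof.
have -> : 32 = 1 * (r 0%N * s) by rewrite /s mul1r mulrCA divff ?mulr1 ?lt0r_neq0.
rewrite -mulrA; apply: ler_pM => //; first by rewrite mulr_ge0 // ltW.
by rewrite ler_pM2r // r_mono.
Qed.

Lemma level_ex n : exists l, d%:R * r n * s <= delta / 8 * 2 ^+ l.
Proof.
have [l hl] := @expr_unbounded R 2 (d%:R * r n * s / (delta / 8)) ltac:(lra).
exists l; move: hl; rewrite ltr_pdivrMr ?divr_gt0 // => /ltW.
by rewrite [_ ^+ l * _]mulrC.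
Qed.

(** The coarsest level at which the bound [d * r n] on the sum of the [|a n 0 i|] keeps the
    oscillation of the form over a cube within [delta / 8]. *)
Definition level n := ex_minn (level_ex n).

Lemma level_le n : d%:R * r n * s <= delta / 8 * 2 ^+ level n.
Proof. by rewrite /level; case: ex_minnP. Qed.

Lemma level_min n l : d%:R * r n * s <= delta / 8 * 2 ^+ l -> (level n <= l)%N.
Proof. by rewrite /level; case: ex_minnP => m _; apply. Qed.

Lemma level_gt0 n : (0 < level n)%N.
Proof.
rewrite lt0n; apply/eqP => e; have := level_le n; have := drs n; rewrite e expr0.
by have := delta_lt; lra.
Qed.

Lemma level_gt n : delta / 16 * 2 ^+ level n < d%:R * r n * s.
Proof.
rewrite ltNge; apply/negP => h.
suff : (level n <= (level n).-1)%N by rewrite leqNgt ltn_predL level_gt0.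
apply: level_min; apply: (le_trans h).
by rewrite -[in leLHS](prednK (level_gt0 n)) exprS; lra.
Qed.

Lemma level_mono : {homo level : m n / (m <= n)%N}.
Proof.
move=> m n mn; apply: level_min; apply: le_trans (level_le n).
by rewrite ler_pM2r // ler_pM2l // r_mono.
Qed.

Lemma level_lac n : (level n < level (n + N))%N.
Proof.
rewrite -(prednK (level_gt0 (n + N))) ltnS; apply: level_min.
have := level_le (n + N); rewrite -[in X in X -> _](prednK (level_gt0 (n + N))) exprS.
have : d%:R * s * (2 * r n) <= d%:R * s * r (n + N)%N.
  by rewrite ler_pM2l; [exact: r_lac | exact: mulr_gt0].
lra.
Qed.

Lemma r_lacX n k : 2 ^+ k * r n <= r (n + N * k)%N.
Proof.
elim: k => [|k IH]; first by rewrite muln0 addn0 expr0 mul1r.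
rewrite mulnS addnCA addnC; apply: le_trans (r_lac _).
by rewrite exprS -mulrA ler_pM2l.
Qed.

(* The [j]-th stage decides which cubes of side [s / 2 ^ stage_level j] avoid the bad sets of
   the indices [m < j - w]; the delay [w] lets the slabs of index [j] be thin on that scale. *)
Definition stage_level j := if (j - w)%N is n.+1 then level n else 0%N.

Lemma stage_level_mono : {homo stage_level : i j / (i <= j)%N}.
Proof.
move=> i j ij; rewrite /stage_level; have := leq_sub2r w ij.
by case: (i - w)%N (j - w)%N => [|m] [|n] //= mn; exact: level_mono.
Qed.

Lemma stage_levelE n : stage_level (n + w).+1 = level n.
Proof. by rewrite /stage_level -addSn addnK. Qed.

Lemma level_le_stage m j : (m < j - w)%N -> (level m <= stage_level j)%N.
Proof.
by move=> mj; rewrite -stage_levelE; apply: stage_level_mono; rewrite addnC -ltn_subRL.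
Qed.

Lemma stage_level_grow j k : (stage_level j + k <= stage_level (j + w + N * k))%N.
Proof.
elim: k => [|k IH].
  by rewrite addn0 muln0 addn0; apply: stage_level_mono; exact: leq_addr.
rewrite addnS; apply: (leq_ltn_trans IH).
have -> : (j + w + N * k.+1 = (j + N * k + N) + w)%N by rewrite mulnS; clear; lia.
have -> : (j + w + N * k = (j + N * k) + w)%N by clear; lia.
rewrite /stage_level !addnK; case: (j + N * k)%N => [|m].
  by rewrite add0n; case: N N0 => // M _; exact: level_gt0.
by rewrite addSn; exact: level_lac.
Qed.

Definition center t (v : 'I_d -> nat) : 'rV[R]_d :=
  \row_i (((v i)%:R + 2^-1) * s / 2 ^+ t).

(** The margin [delta / 16] covers the change of the form between the centre and any other point of
    the cube. *)
Definition bad m (v : 'I_d -> nat) :=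
  distZ (affine (a m) (b m) (center (level m) v)) < 17 / 16 * delta.

Definition safe j (v : 'I_d -> nat) :=
  [forall m : 'I_(j - w), ~~ bad m (supercube (2 ^ (stage_level j - level m)) v)].

Lemma safeP j v : reflect
  (forall m, (m < j - w)%N -> ~~ bad m (supercube (2 ^ (stage_level j - level m)) v))
  (safe j v).
Proof.
by apply: (iffP forallP) => [h m mj|h m]; [exact: (h (Ordinal mj)) | exact: h].
Qed.

Lemma safe_super j j' v : (j <= j')%N -> safe j' v ->
  safe j (supercube (2 ^ (stage_level j' - stage_level j)) v).
Proof.
move=> jj' /safeP sv; apply/safeP => m mj.
rewrite supercubeB ?sv ?level_le_stage ?stage_level_mono //.
exact: leq_trans mj (leq_sub2r w jj').
Qed.

(** Along a coordinate with [|a j 0 i| >= r j] the values at the centres form a progression of step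
    [h] with [|h| <= delta / 8] and length at least 32, so [freq_near_int] applies with
    [rho = 17 / 16 * delta]. *)
Lemma avg_bad_le j v :
  avg (2 ^ (level j - stage_level j)) (fun u => (bad j u)%:R : R) v <= 81 / 32 * delta.
Proof.
have [i ri] := coord_ge j.
pose t := stage_level j; pose n := (2 ^ (level j - t))%N.
have tl : (t <= level j)%N.
  by rewrite -stage_levelE; apply: stage_level_mono; exact: leqW (leq_addr _ _).
apply: (avg_le_slice (i := i)) => [|u]; first by rewrite expn_gt0.
rewrite -/t -/n.
pose h : R := a j 0 i * (s / 2 ^+ level j).
pose c0 : R := affine (a j) (b j) (center (level j) (with_coord u i (n * v i)%N)).
have sl : 0 < s / 2 ^+ level j by rewrite divr_gt0 ?exprn_gt0.
have hE : `|h| = `|a j 0 i| * (s / 2 ^+ level j) by rewrite normrM (gtr0_norm sl).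
have ai0 : 0 < `|a j 0 i| by apply: lt_le_trans ri.
have hle : `|h| <= delta / 8.
  rewrite hE mulrA ler_pdivrMr ?exprn_gt0 //; apply: le_trans (level_le j).
  rewrite ler_pM2r //; apply: le_trans (sum_le j).
  by rewrite (bigD1 i) //= lerDl sumr_ge0.
have nh : 32 <= n%:R * `|h|.
  have -> : n%:R * `|h| = `|a j 0 i| * s / 2 ^+ t.
    have -> : n%:R = 2 ^+ (level j - t) :> R by rewrite natrX.
    have e : 2 ^+ level j = 2 ^+ (level j - t) * 2 ^+ t :> R by rewrite -exprD subnK.
    by rewrite hE e; field; rewrite !expf_neq0 ?pnatr_eq0.
  rewrite ler_pdivlMr ?exprn_gt0 //; apply: (@le_trans _ _ (r j * s)); last first.
    by rewrite ler_pM2r.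
  (* If [j <= w] the cube has side [s = 32 / r 0]. Otherwise [j = m + N * H], the side exceeds
     [delta / (16 * d * r m)], and [r j >= 2 ^+ H * r m] makes up for it by [HE]. *)
  rewrite /t /stage_level; case E: (j - w)%N => [|m].
    rewrite expr0 mulr1 /s mulrCA ler_peMr // ler_pdivlMr // mul1r.
    exact: r_mono.
  have jE : j = (m + N * H)%N by clear -E wE; lia.
  apply: (@le_trans _ _ (2 ^+ H * r m * s)); last first.
    by rewrite ler_pM2r // jE; exact: r_lacX.
  have rs : 0 < r m * s by rewrite mulr_gt0.
  rewrite -mulrA; apply: (@le_trans _ _ (512 * d%:R / delta * (r m * s))); last first.
    by rewrite ler_pM2r.
  have -> : 512 * d%:R / delta * (r m * s) = 512 * (d%:R * r m * s) / delta.
    by field; exact: lt0r_neq0.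
  by rewrite ler_pdivlMr //; have := level_gt m; lra.
have -> : 81 / 32 * delta = 9 / 8 * (2 * (17 / 16 * delta) + delta / 8) by field.
apply: (@le_trans _ _ (9 / 8 * (2 * (17 / 16 * delta) + `|h|) * n%:R)); last first.
  by rewrite ler_pM2r ?ltr0n ?expn_gt0 // ler_pM2l; lra.
apply: le_trans (@freq_near_int R n c0 h (17 / 16 * delta) _ _ nh); last 2 first.
- by rewrite -normr_gt0 hE mulr_gt0.
- apply/andP; split; first by rewrite mulr_gt0.
  by have := delta_lt; move: delta => y; lra.
apply: ler_sum => c _; rewrite ler_nat.
case: (boolP (bad j _)) => // bc; case: asboolP => // -[].
have [[z zE] _] := distZ_min (affine (a j) (b j)
  (center (level j) (with_coord u i (n * v i + c)%N))).
exists z; move: bc; rewrite /bad zE; congr (`|_ - _| < _).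
rewrite /c0 /affine (bigD1 i) //= [in RHS](bigD1 i) //= !mxE /with_coord eqxx natrD.
have -> : \sum_(k < d | k != i) a j 0 k * center (level j)
      (fun k => if k == i then (n * v i + c)%N else u k) 0 k =
    \sum_(k < d | k != i) a j 0 k * center (level j)
      (fun k => if k == i then (n * v i)%N else u k) 0 k.
  by apply: eq_bigr => k /negbTE ki; rewrite !mxE ki.
rewrite /h; ring.
Qed.

Let F j v : R := (safe j v)%:R.

(** From stage [j + w] to the next, the only new index is [j], whose bad cubes have frequency at
    most [1 / (3 * N * H) <= x * (1 - x) ^+ w]. The factor [F j v] is harmless, since safety at
    stage [j + w] implies safety at stage [j]. *)
Lemma survival_safe_step j v :
  survival stage_level F j w v - x * (1 - x) ^+ w * F j v <=
  survival stage_level F j w.+1 v.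
Proof.
set t := stage_level j; set t1 := stage_level (j + w); set t2 := level j.
have tt1 : (t <= t1)%N by apply: stage_level_mono; exact: leq_addr.
have t12 : (t1 <= t2)%N by rewrite /t2 -stage_levelE; apply: stage_level_mono.
(* Both frequencies are read at the finer level [t2], where they are compared cube by cube. *)
have -> : survival stage_level F j w v =
    avg (2 ^ (t2 - t)) (fun u => F (j + w)%N (supercube (2 ^ (t2 - t1)) u)) v.
  have -> : (t2 - t = (t1 - t) + (t2 - t1))%N by rewrite addnC addnBA // subnK.
  rewrite expnD avgM /survival; apply: eq_avg => u _.
  by rewrite avg_super // expn_gt0.
have -> : survival stage_level F j w.+1 v = avg (2 ^ (t2 - t)) (F (j + w).+1) v.
  by rewrite /survival addnS stage_levelE.
apply: (@le_trans _ _ (avg (2 ^ (t2 - t)) (fun u =>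
    F (j + w)%N (supercube (2 ^ (t2 - t1)) u) - F j v * (bad j u)%:R) v)).
  rewrite avgB avgZ lerD2l lerN2 [leRHS]mulrC; apply: ler_wpM2l => //.
  apply: (le_trans (avg_bad_le j v)).
  have W0 : 0 < (N * H)%:R :> R by rewrite ltr0n ltnW // ltnW.
  apply: (@le_trans _ _ (x * 3^-1)); last first.
    apply: ler_wpM2l; first by rewrite invr_ge0 ltW.
    by rewrite /x -wE; exact: exprn_1BV_ge.
  by rewrite /x [leRHS]mulrC ler_pdivlMr //; have := delta_le; lra.
apply: le_avg => u uv; rewrite /F.
case: (boolP (safe (j + w) _)) => [sj|_]; last first.
  by rewrite add0r; apply: le_trans (ler0n _ _); rewrite oppr_le0 mulr_ge0.
have -> : safe j v.
  move: sj => /(safe_super (leq_addr w j)); rewrite -/t -/t1 supercubeB ?uv //.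
  by rewrite tt1.
rewrite mul1r; case: (boolP (bad j u)) => [_|nb]; first by rewrite subrr.
rewrite subr0 ler_nat lt0b; apply/safeP => m; rewrite -addSn addnK ltnS leq_eqVlt.
move=> /predU1P[->|mj].
  by rewrite addSn stage_levelE subnn expn0 supercube1.
rewrite addSn stage_levelE -(@supercubeB _ (level m) t1 (level j)).
  2: by rewrite t12 andbT; apply: level_le_stage; rewrite addnK.
by move/safeP: sj; apply; rewrite addnK.
Qed.

Lemma lacunary_cantor_set : exists g : (nat -> bool) -> 'rV[R]_d,
  injective (fun c => g c 0 i0) /\
  forall c n, delta <= distZ (affine (a n) (b n) (g c)).
Proof.
have W0 : 0 < (N * H)%:R :> R by rewrite ltr0n ltnW // ltnW.
have x01 : 0 < x < 1.
  by rewrite invr_gt0 W0 invf_lt1 // ltr1n ltnW.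
have F01 j v : 0 <= F j v <= 1 by rewrite /F; case: (safe j v); rewrite ?lexx ?ler01.
have F_super j j' v : (j <= j')%N -> 0 < F j' v ->
    0 < F j (supercube (2 ^ (stage_level j' - stage_level j)) v).
  by move=> jj'; rewrite /F !ltr0n !lt0b; exact: safe_super.
(* By Bernoulli [(1 - x) ^+ N >= 1 - N * x = 1 - 1 / H], which is at least [2 / 3] because
   [H >= 3]. *)
have lamN : 1 < 2 * (1 - x) ^+ N.
  have x1 : -1 <= - x by case/andP: x01 => ? ?; lra.
  have := bernoulli_ineq N x1.
  have : N%:R * x <= 3^-1.
    rewrite /x natrM invfM mulrA divff ?pnatr_eq0 -?lt0n // mul1r.
    by rewrite lef_pV2 ?posrE ?ltr0n ?ler_nat // ltnW // ltnW.
  lra.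
pose good j v := 0 < potential w stage_level F x j v.
have good0 : good 0%N (fun=> 0%N).
  rewrite /good (potential_start _ x01) => [|j u jw].
    by rewrite exprn_gt0 // (lam_gt0 x01).
  rewrite /F; suff -> : safe j u by [].
  by apply/safeP => m; have /eqP -> := jw.
have [g [ginj gP]] := cantor_scheme (i0 := i0) s0 stage_level_mono
  (potential_split x01 stage_level_mono survival_safe_step F01 N0
     stage_level_grow lamN i0) good0.
exists g; split=> // c n.
(* Stage [n + w + 1] is the first to take index [n] into account. *)
have [j [u [nj gu cu]]] := gP c (n + w).+1.
have nj' : (n < j - w)%N by rewrite ltn_subRL addnC.
have : safe j u.
  have := potential_gt0 x01 F01 F_super gu.
  by rewrite /F ltr0n lt0b.
move/safeP/(_ n nj'); rewrite /bad -leNgt.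
set u' := supercube _ u => h.
have := distZ_lipschitz (affine (a n) (b n) (center (level n) u')) (affine (a n) (b n) (g c)).
have ln : 0 < 2 ^+ level n :> R by rewrite exprn_gt0.
have sl : 0 < s / 2 ^+ level n by rewrite divr_gt0.
have : `|affine (a n) (b n) (center (level n) u') - affine (a n) (b n) (g c)| <= delta / 16.
  apply: (le_trans (@affine_dist_le _ _ _ _ _ _ (s / 2 ^+ level n / 2) _)).
    move=> i; have /andP[h1 h2] := cu i; rewrite mxE.
    have [h3 h4] := supercube_itv s0 u i (level_le_stage nj').
    have := le_trans h3 h1; have := le_trans h2 h4; rewrite -/u' -natr1 ler_norml.
    set y := s / _ in sl *; rewrite -!mulrA -/y => ? ?.
    by apply/andP; split; lra.
  apply: (@le_trans _ _ (d%:R * r n * (s / 2 ^+ level n / 2))).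
    by rewrite ler_pM2r ?divr_gt0.
  have := level_le n; rewrite -ler_pdivrMr // -!mulrA; lra.
lra.
Qed.

End lacunary.

(** * Comparison of the [p]-norm with the mean and the maximum *)

(** The tangent at 1 lies below the convex power; this is the Young inequality for the product
    [y * 1]. *)
Lemma powR_ge_tangent1 (R : realType) (y p : R) : 0 <= y -> 1 <= p ->
  1 + p * (y - 1) <= y `^ p.
Proof.
move=> y0; rewrite le_eqVlt => /predU1P[<-|p1]; first by rewrite powRr1 // mul1r; lra.
have p0 : 0 < p by lra.
have q0 : 0 < p / (p - 1) by rewrite divr_gt0 // subr_gt0.
have pq : p^-1 + (p / (p - 1))^-1 = 1.
  by field; rewrite subr_eq0 gt_eqF //= gt_eqF.
have := conjugate_powR y0 ler01 p0 q0 pq.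
rewrite powR1 mulr1 mul1r (_ : (p / (p - 1))^-1 = 1 - p^-1); last by lra.
rewrite -(ler_pM2l p0) mulrDr mulrCA divff ?lt0r_neq0 // mulr1.
by rewrite mulrBr divff ?lt0r_neq0 //; lra.
Qed.

(** The power mean inequality: in the sum of the tangent bounds at the mean [m], the linear terms
    cancel. *)
Lemma sum_powR_ge (R : realType) d (y : 'I_d -> R) (p : R) : (0 < d)%N -> 1 <= p ->
  (forall i, 0 <= y i) ->
  d%:R * ((\sum_i y i) / d%:R) `^ p <= \sum_i y i `^ p.
Proof.
move=> d0 p1 y0; have dR : 0 < d%:R :> R by rewrite ltr0n.
have p0 : 0 < p by lra.
set m := (\sum_i y i) / d%:R.
have : 0 <= m by rewrite divr_ge0 ?sumr_ge0 // ltW.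
rewrite le_eqVlt => /predU1P[<-|m0].
  by rewrite powR0 ?lt0r_neq0 // mulr0 sumr_ge0 // => i _; exact: powR_ge0.
have mp0 := powR_gt0 p m0.
have h i : m `^ p * (1 + p * (y i / m - 1)) <= y i `^ p.
  have ym : 0 <= y i / m by rewrite divr_ge0 // ltW.
  have -> : y i `^ p = m `^ p * (y i / m) `^ p.
    by rewrite -powRM ?(ltW m0) // mulrC divfK ?lt0r_neq0.
  by rewrite ler_pM2l // powR_ge_tangent1.
apply: le_trans (ler_sum _ (fun i _ => h i)).
rewrite -mulr_sumr big_split /= -mulr_sumr big_split /= -mulr_suml.
rewrite !sumr_const card_ord mulNrn.
have -> : (\sum_i y i) / m = d%:R.
  have E : \sum_i y i = m * d%:R by rewrite divfK ?lt0r_neq0.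
  by rewrite E mulrAC divff ?mul1r ?lt0r_neq0.
by rewrite subrr mulr0 addr0 mulrC.
Qed.

Lemma sum_le_cst (R : realDomainType) d (f : 'I_d -> R) M :
  (forall i, f i <= M) -> \sum_i f i <= d%:R * M.
Proof.
move=> fM; apply: (@le_trans _ _ (\sum_(i < d) M)); first exact: ler_sum.
by rewrite sumr_const card_ord mulr_natl.
Qed.

Lemma ex_max_coord (R : realType) d (a : 'rV[R]_d) : (0 < d)%N ->
  exists i, forall j, `|a 0 j| <= `|a 0 i|.
Proof.
move=> d0; case: (@Order.TotalTheory.arg_maxP _ _ _ (Ordinal d0) xpredT
  (fun i => `|a 0 i|)) => // i _ iP.
by exists i => j; exact: iP.
Qed.

(** With [c = d ^ (-1/p)], or 1 for infinite [p], [c * pnorm p a] is a power mean of the [|a 0 i|]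
    and lies between their arithmetic mean and their maximum. *)
Lemma pnorm_comparison (R : realType) (p : \bar R) d : (0 < d)%N -> (1 <= p)%E ->
  exists2 c, 0 < c & forall a : 'rV[R]_d,
    \sum_i `|a 0 i| <= d%:R * (c * pnorm p a) /\ exists i, c * pnorm p a <= `|a 0 i|.
Proof.
move=> d0; have dR : 0 < d%:R :> R by rewrite ltr0n.
case: p => [p||] // p1; last first.
  exists 1 => // a; have [i iP] := ex_max_coord a d0.
  have -> : 1 * pnorm +oo%E a = `|a 0 i|.
    rewrite mul1r; apply/eqP; rewrite eq_le; apply/andP; split.
      exact: bigmax_le.
    exact: le_bigmax.
  by split; [exact: sum_le_cst | exists i].
rewrite lee_fin in p1; have p0 : 0 < p by lra.
have pV : 0 <= p^-1 by rewrite invr_ge0 ltW.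
have powK (y : R) : 0 <= y -> (y `^ p) `^ p^-1 = y.
  by move=> y0; rewrite -powRrM divff ?lt0r_neq0 // powRr1.
have dp0 := powR_gt0 p^-1 dR.
exists (d%:R `^ p^-1)^-1 => [|a]; first by rewrite invr_gt0.
have [i iP] := ex_max_coord a d0.
have S0 : 0 <= \sum_i `|a 0 i| `^ p by apply: sumr_ge0 => j _; exact: powR_ge0.
split; last first.
  exists i; rewrite mulrC ler_pdivrMr // -[`|a 0 i|]powK // -powRM ?powR_ge0 ?(ltW dR) //.
  rewrite /pnorm; apply: ge0_ler_powR; rewrite ?nnegrE ?mulr_ge0 ?powR_ge0 ?(ltW dR) //.
  rewrite mulrC; apply: sum_le_cst => j.
  by apply: ge0_ler_powR; rewrite ?nnegrE // ltW.
have := sum_powR_ge d0 p1 (fun i => normr_ge0 (a 0 i)).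
set m := _ / _ => h.
have m0 : 0 <= m by rewrite divr_ge0 ?sumr_ge0 // ltW.
rewrite -ler_pdivrMl // [leLHS]mulrC -/m -ler_pdivrMl ?invr_gt0 // invrK.
rewrite -[m]powK // -powRM ?powR_ge0 ?(ltW dR) //.
by rewrite /pnorm ge0_ler_powR ?nnegrE ?mulr_ge0 ?powR_ge0 ?(ltW dR).
Qed.

(** * The numerical choice of [H] *)

Lemma ln2_itv (R : realType) : 1 / 2 <= ln (2 : R) <= 1.
Proof.
apply/andP; split; last by have := @le_ln1Dx R 1 (ltac:(lra)).
rewrite -ler_expR lnK ?posrE //.
have := @expR_ge1Dx R (- (1 / 2)); rewrite expRN => h.
by rewrite -[leLHS]invrK invf_ple ?posrE ?invr_gt0 ?expR_gt0 //; lra.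
Qed.

(* With [delta = 1 / (8 N T)], any [H] slightly above [12 + log2 (N d T)] satisfies the third
   inequality, and [13 + log2 (N d T) <= T] gives the last one. *)
Lemma delta_scale (R : realType) (N d : nat) : (0 < N)%N -> (0 < d)%N ->
  exists H, [/\ (2 < H)%N, 0 < delta R N d,
    512 * d%:R / delta R N d <= 2 ^+ H & 243 / 32 * delta R N d * (N * H)%:R <= 1].
Proof.
move=> N0 d0; have /andP[ln2l ln2u] := ln2_itv R.
have l2 : 0 < ln 2 :> R by lra.
have NR : 0 < N%:R :> R by rewrite ltr0n.
have dR : 0 < d%:R :> R by rewrite ltr0n.
have lnE (z : R) : ln z = log2 z * ln 2 by rewrite divfK ?lt0r_neq0.
have Nd1 : 1 <= (N * d)%:R :> R by rewrite ler1n muln_gt0 N0.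
have Nd0 : 0 < (N * d)%:R :> R by lra.
rewrite /delta; set L : R := log2 (N * d)%:R; pose y : R := L + 36; set T : R := L + _.
have L0 : 0 <= L by apply: divr_ge0; [exact: ln_ge0 | exact: ltW].
have y36 : 36 <= y by rewrite /y lerDr.
have y0 : 0 < y by lra.
have logy : 1 <= log2 y <= y.
  apply/andP; split; first by rewrite /log2 ler_pdivlMr // mul1r ler_ln ?posrE //; lra.
  have h : ln (y / 2) <= y / 2 - 1.
    have -> : y / 2 = 1 + (y / 2 - 1) by ring.
    by rewrite [leRHS]addrAC subrr add0r; apply: le_ln1Dx; lra.
  rewrite ln_div ?posrE // in h.
  rewrite /log2 ler_pdivrMr //; apply: (@le_trans _ _ (y / 2)); first by lra.
  by rewrite ler_pM2l //; lra.
have [logy1 logy2] := andP logy.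
have TE : T = L + 4 * log2 y by [].
have T1 : 1 <= T by rewrite TE; lra.
have T0 : 0 < T by lra.
have T5 : T <= 5 * y by rewrite TE /y; move: logy2; rewrite /y; lra.
have logT0 : 0 <= log2 T by apply: divr_ge0; [exact: ln_ge0 | exact: ltW].
(* Here the constant 36 enters: [2^13 * T <= 2^13 * 5 * y <= 36^3 * y <= y^4]. *)
have logT : 13 + log2 T <= 4 * log2 y.
  have : ln (2 ^+ 13 * T) <= ln (y ^+ 4).
    rewrite ler_ln ?posrE ?mulr_gt0 ?exprn_gt0 //.
    apply: (@le_trans _ _ (36 ^+ 3 * y)).
      apply: (@le_trans _ _ (2 ^+ 13 * (5 * y))); first by rewrite ler_pM2l // exprn_gt0.
      by rewrite mulrA ler_pM2r //; lra.
    rewrite [leRHS]exprSr ler_pM2r //.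
    by apply: lerXn2r => //; rewrite nnegrE; [lra | exact: ltW].
  rewrite lnM ?posrE ?exprn_gt0 // !lnXn //.
  rewrite -[ln 2 *+ _]mulr_natl -[ln y *+ _]mulr_natl => h.
  by move: h; rewrite (lnE T) (lnE y) mulrA -mulrDl ler_pM2r.
(* [A] is the binary logarithm of [512 * d / delta]; rounding up costs at most 1, so
   [H <= A + 1 <= T]. *)
pose A := 12 + L + log2 T.
have A0 : 0 <= A by rewrite /A; lra.
have /andP[Hl Hu] := truncn_itv A0.
set H := (Num.truncn A).+1 in Hu.
have HT : H%:R <= T by rewrite /H -natr1 TE; move: Hl; rewrite /A; lra.
exists H; split.
- rewrite -(ltr_nat R); apply: lt_trans Hu; rewrite /A; lra.
- by rewrite div1r invr_gt0 !mulr_gt0.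
- have -> : 512 * d%:R / (1 / (8 * N%:R * T)) = 2 ^+ 12 * ((N * d)%:R * T).
    by rewrite natrM; field; rewrite !lt0r_neq0.
  rewrite -ler_ln ?posrE ?mulr_gt0 ?exprn_gt0 //.
  rewrite lnM ?posrE ?mulr_gt0 ?exprn_gt0 // lnM ?posrE // !lnXn //.
  rewrite -[ln 2 *+ 12]mulr_natl -[ln 2 *+ H]mulr_natl.
  rewrite (lnE T) (lnE (N * d)%:R) -/L.
  have -> : 12 * ln 2 + (L * ln 2 + log2 T * ln 2) = A * ln 2 by rewrite /A; ring.
  by rewrite ler_pM2r // ltW.
- rewrite natrM.
  have -> : 243 / 32 * (1 / (8 * N%:R * T)) * (N%:R * H%:R) = 243 * H%:R / (256 * T).
    by field; rewrite !lt0r_neq0.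
  by rewrite ler_pdivrMr ?mulr_gt0 //; lra.
Qed.

(** * Cardinality of the continuum *)

(** A vector is determined by the Dedekind cuts of its coordinates, that is, by a subset of a
    countable set. *)
Lemma rV_card_le_cantor (R : realType) d : exists f : 'rV[R]_d -> nat -> bool, injective f.
Proof.
pose cut (x : 'rV[R]_d) (iq : 'I_d * rat) := ratr iq.2 < x 0 iq.1.
exists (fun x n => if unpickle n is Some iq then cut x iq else false) => x y e.
have {}e iq : cut x iq = cut y iq.
  by have := congr1 (fun f => f (pickle iq)) e; rewrite pickleK.
apply/rowP => i; apply/eqP; rewrite eq_le !leNgt.
apply/andP; split; apply/negP => /rat_in_itvoo[q]; rewrite in_itv /= => /andP[q1 q2].
  have := e (i, q); rewrite /cut /= q2 => /esym/(lt_trans q1); by rewrite ltxx.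
have := e (i, q); rewrite /cut /= q2 => /(lt_trans q1); by rewrite ltxx.
Qed.

(** Cantor-Bernstein: vectors and reals both embed in the binary sequences; these embed in [A] by
    [g], and in the reals by coordinate [i] of [g]. *)
Lemma card_continuum (R : realType) d (A : set 'rV[R]_d) (g : (nat -> bool) -> 'rV[R]_d)
    (i : 'I_d) : injective (fun c => g c 0 i) -> (forall c, A (g c)) -> A #= [set: R].
Proof.
move=> ginj gA; apply: Cantor_Bernstein.
  have [f finj] := rV_card_le_cantor R d.
  have hinj : injective (fun x => g (f x) 0 i) by move=> x y /ginj/finj.
  rewrite -(card_le_eql (inj_card_eq (A := A) (in2W hinj))).
  exact: subset_card_le.
have [f finj] := rV_card_le_cantor R 1.
pose h (x : R) := g (f (const_mx x)).
have hinj : injective h.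
  move=> x y e; have /finj/matrixP/(_ 0 0) : f (const_mx x) = f (const_mx y).
    by apply: ginj; rewrite -/(h x) -/(h y) e.
  by rewrite !mxE.
rewrite -(card_le_eql (inj_card_eq (in2W hinj))).
by apply: subset_card_le => _ [x _ <-]; exact: gA.
Qed.

(** * Lacunary forms bounded away from the integers *)

Theorem theorem2 (R : realType) (d : nat) (p : \bar R)
    (a : nat -> 'rV[R]_d) (b : nat -> R) (N : nat)
    (hd : (0 < d)%N)
    (hp : (1 <= p)%E)
    (hN : (0 < N)%N)
    (hpos : 0 < pnorm p (a 0%N))
    (hmono : forall n : nat, pnorm p (a n) <= pnorm p (a n.+1))
    (hlac : forall n : nat, pnorm p (a (n + N)%N) / pnorm p (a n) >= 2) :
  [set theta : 'rV[R]_d |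
     inf [set distZ (affine (a n) (b n) theta) | n in [set: nat]] >= delta R N d]
  #= [set: R].
Proof.
have [c c0 cP] := @pnorm_comparison R p d hd hp.
have [H [H3 delta0 HE delta_le]] := @delta_scale R N d hN hd.
have mono : {homo (fun n => pnorm p (a n)) : m n / (m <= n)%N >-> m <= n}.
  by apply: homo_leq => // y x z; exact: le_trans.
(* The factor [c] leaves all ratios unchanged and gives the bounds on coordinates that the lacunary
   construction uses in place of the norm. *)
pose r n := c * pnorm p (a n).
have r0 : 0 < r 0%N by rewrite mulr_gt0.
have r_mono : {homo r : m n / (m <= n)%N >-> m <= n}.
  by move=> m n mn; rewrite ler_pM2l // mono.
have r_lac n : 2 * r n <= r (n + N)%N.
  rewrite mulrCA ler_pM2l // -ler_pdivlMr ?hlac //.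
  exact: lt_le_trans hpos (mono _ _ (leq0n n)).
have [g [ginj gP]] := @lacunary_cantor_set R d a b r N H (delta R N d) (Ordinal hd)
  hN H3 delta0 HE delta_le r0 r_mono r_lac (fun n => (cP (a n)).1) (fun n => (cP (a n)).2).
apply: card_continuum ginj _ => x; apply: lb_le_inf.
  by exists (distZ (affine (a 0%N) (b 0%N) (g x))); exists 0%N.
by move=> _ [n _ <-]; exact: gP.
Qed.
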